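(* Let $P$ be a countable meet-continuous dcpo such that, for every $r\in P$, every nonempty subset of the principal ideal $\mathord{\downarrow}r$ has a supremum in $\mathord{\downarrow}r$. (In particular, $P$ may be a countable meet-continuous $L$-dcpo.) If any one of the following conditions holds, then the Scott space $\Sigma P$ is sober: (1) $\Sigma P$ is a strong $d$-space; (2) $\Sigma P$ has property $R$; (3) $\Sigma P$ is well-filtered and coherent; (4) $(P,\lambda(P))$ is upper-semicompact.
   Context: All posets and directed sets are nonempty; countable sets may be finite. A subset $D$ of a poset is directed if any two of its elements have a common upper bound in $D$. A dcpo is a poset in which every directed subset has a supremum. Write $\mathord{\downarrow}x=\{y:y\le x\}$, $\mathord{\uparrow}x=\{y:x\le y\}$, $\mathord{\downarrow}A=\bigcup_{a\in A}\mathord{\downarrow}a$ and $\mathord{\uparrow}A=\bigcup_{a\in A}\mathord{\uparrow}a$. A supremum in $\mathord{\downarrow}r$ means a least upper bound computed in $\mathord{\downarrow}r$ with its induced order. For a dcpo $P$, an upper set $U\subseteq P$ is Scott open if for every directed $D\subseteq P$, $\bigvee D\in U$ implies $D\cap U\neq\emptyset$; the Scott open sets form the Scott topology $\sigma(P)$, and $\Sigma P=(P,\sigma(P))$ is the Scott space (its specialization order is the order of $P$). A dcpo $P$ is meet-continuous if for every $x\in P$ and every directed $D\subseteq P$, $x\le\bigvee D$ implies $x\in\operatorname{cl}_{\sigma(P)}(\mathord{\downarrow}x\cap\mathord{\downarrow}D)$. A dcpo $P$ is an $L$-dcpo if every principal ideal $\mathord{\downarrow}r$ is a complete lattice in its induced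 order. A nonempty Scott-closed set $A$ is irreducible if any two open sets meeting $A$ have an intersection meeting $A$. $\Sigma P$ is sober if each irreducible closed set $A$ equals $\mathord{\downarrow}a$ for a unique $a\in P$. For a $T_0$ space $X$, the symbol $\mathord{\uparrow}$ refers to the specialization order. $X$ is a strong $d$-space if for every nonempty set $D$ directed in the specialization order, every $x\in X$ and every open $U\subseteq X$, $\bigcap_{d\in D}(\mathord{\uparrow}d\cap\mathord{\uparrow}x)\subseteq U$ implies $\mathord{\uparrow}d\cap\mathord{\uparrow}x\subseteq U$ for some $d\in D$. $X$ has property $R$ if for every family $(F_i)_{i\in I}$ of finite subsets of $X$ and every open $U$, $\bigcap_{i\in I}\mathord{\uparrow}F_i\subseteq U$ implies $\bigcap_{i\in I_0}\mathord{\uparrow}F_i\subseteq U$ for some finite $I_0\subseteq I$. $X$ is well-filtered if for every filtered (down-directed under inclusion) family $\mathcal K$ of compact saturated sets and every open $U$, $\bigcap\mathcal K\subseteq U$ implies $K\subseteq U$ for some $K\in\mathcal K$; $X$ is coherent if the intersection of any two compact saturated sets is compact. $\lambda(P)$ is the Lawson topology: the join of the Scott topology and the lower topology generated by the sets $P\setminus\mathord{\uparrow}x$, $x\in P$. $(P,\lambda(P))$ is upper-semicompact if every principal upper set $\mathord{\uparrow}x$ is compact in $\lambda(P)$. *)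

(* Defs.v *)
From HB Require Import structures.
From mathcomp Require Import all_boot all_order.
From mathcomp Require Import all_classical topology.

Set Implicit Arguments.
Unset Strict Implicit.
Unset Printing Implicit Defensive.

Import Order.TTheory.
Local Open Scope classical_set_scope.
Local Open Scope order_scope.

Definition directed_for (T : Type) (le : T -> T -> Prop) (D : set T) : Prop :=
  D !=set0 /\
  forall x y, D x -> D y -> exists z, [/\ D z, le x z & le y z].

Section Poset.
Context {d : Order.disp_t} {P : porderType d}.
Implicit Types (x y r s : P) (A D U : set P).

Definition directed D : Prop := directed_for (fun x y => x <= y) D.

Definition below r : set P := [set y | y <= r].
Definition above x : set P := [set y | x <= y].

Definition scott_open U : Prop :=
  (forall x y, U x -> x <= y -> U y) /\
  (forall D s, directed D -> isLub D s -> U s -> D `&` U !=set0).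

(* least upper bound (resp. greatest lower bound) computed in the principal
   ideal of r: only bounds lying in that ideal are competitors *)
Definition isLub_below r A s : Prop :=
  [/\ s <= r, ubound A s & forall t, t <= r -> ubound A t -> s <= t].
Definition isGlb_below r A s : Prop :=
  [/\ s <= r, lbound A s & forall t, t <= r -> lbound A t -> t <= s].

Lemma scott_openT : scott_open setT.
Proof. by split=> // D s [[x Dx] _] _ _; exists x. Qed.

Lemma scott_openI : setI_closed scott_open.
Proof.
move=> U V [Uup Uscott] [Vup Vscott]; split=> [x y [Ux Vx] xy|D s dirD Ds [Us Vs]].
  by split; [exact: Uup xy|exact: Vup xy].
have [x [Dx Ux]] := Uscott _ _ dirD Ds Us.
have [y [Dy Vy]] := Vscott _ _ dirD Ds Vs.
have [z [Dz xz yz]] := dirD.2 _ _ Dx Dy.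
by exists z; split=> //; split; [exact: Uup xz|exact: Vup yz].
Qed.

Lemma scott_open_bigU (I : Type) (f : I -> set P) :
  (forall i, scott_open (f i)) -> scott_open (\bigcup_i f i).
Proof.
move=> fo; split=> [x y [i _ fix_] xy|D s dirD Ds [i _ fis]].
  by exists i => //; exact: (fo i).1 xy.
have [x [Dx fix_]] := (fo i).2 _ _ dirD Ds fis.
by exists x; split=> //; exists i.
Qed.

End Poset.

Definition scott {d : Order.disp_t} (P : porderType d) : Type := P.

HB.instance Definition _ d (P : porderType d) := Order.POrder.on (scott P).
HB.instance Definition _ d (P : porderType d) :=
  @isOpenTopological.Build (scott P) (@scott_open d P)
    scott_openT scott_openI (@scott_open_bigU d P).

Definition lawson {d : Order.disp_t} (P : porderType d) : Type := P.

Definition lawson_subbase {d : Order.disp_t} (P : porderType d) :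
    set (set P) :=
  [set U | scott_open U \/ exists x : P, U = ~` above x].

HB.instance Definition _ d (P : porderType d) := Order.POrder.on (lawson P).
HB.instance Definition _ d (P : porderType d) :=
  @isSubBaseTopological.Build (lawson P) (set P) (@lawson_subbase d P) id.

Section Space.
Context {X : topologicalType}.
Implicit Types (x y : X) (A D F K U : set X).

(* specialization preorder: every neighbourhood of x contains y *)
Definition spec_le x y : Prop := closure [set y] x.
Definition spec_above x : set X := [set y | spec_le x y].
Definition spec_up A : set X := \bigcup_(a in A) spec_above a.

Definition saturated A : Prop :=
  A = \bigcap_(U in [set U | open U /\ A `<=` U]) U.

Definition irreducible_closed A : Prop :=
  [/\ closed A, A !=set0 &
      forall U V : set X, open U -> open V ->
        A `&` U !=set0 -> A `&` V !=set0 -> A `&` (U `&` V) !=set0].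

End Space.

Section SpaceProperties.
Variable X : topologicalType.

Definition strong_d_space : Prop :=
  forall (D : set X) (x : X) (U : set X),
    directed_for spec_le D -> open U ->
    \bigcap_(e in D) (spec_above e `&` spec_above x) `<=` U ->
    exists2 e, D e & spec_above e `&` spec_above x `<=` U.

Definition property_R : Prop :=
  forall (I : Type) (F : I -> set X) (U : set X),
    (forall i, finite_set (F i)) -> open U ->
    \bigcap_i spec_up (F i) `<=` U ->
    exists2 I0 : set I, finite_set I0 & \bigcap_(i in I0) spec_up (F i) `<=` U.

Definition well_filtered : Prop :=
  forall (KK : set (set X)) (U : set X),
    (forall K, KK K -> compact K /\ saturated K) ->
    directed_for (fun K L => L `<=` K) KK -> open U ->
    \bigcap_(K in KK) K `<=` U ->
    exists2 K, KK K & K `<=` U.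

Definition coherent : Prop :=
  forall K L : set X, compact K -> saturated K -> compact L -> saturated L ->
    compact (K `&` L).

End SpaceProperties.

Section PosetProperties.
Context {d : Order.disp_t} (P : porderType d).

Definition is_dcpo : Prop :=
  forall D : set P, directed D -> exists s, isLub D s.

Definition meet_continuous : Prop :=
  forall (x : P) (D : set P) (s : P), directed D -> isLub D s -> x <= s ->
    closure (below x `&` down D : set (scott P)) x.

Definition nonempty_sups_below : Prop :=
  forall (r : P) (A : set P), A !=set0 -> A `<=` below r ->
    exists s, isLub_below r A s.

Definition is_L_dcpo : Prop :=
  is_dcpo /\
  forall (r : P) (A : set P), A `<=` below r ->
    (exists s, isLub_below r A s) /\ (exists s, isGlb_below r A s).

Definition scott_sober : Prop :=
  forall A : set P, irreducible_closed (A : set (scott P)) ->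
    exists! a : P, A = below a.

Definition lawson_upper_semicompact : Prop :=
  forall x : P, compact (above x : set (lawson P)).

End PosetProperties.

(* Main.v *)
(* Each of (2), (3), (4) implies (1), so let Sigma P be a strong d-space.
   Countability and meet-continuity make Scott openness of an upper set V
   testable by countably many conditions "if t is in V then V meets K_t",
   where t lies in the closure of K_t.  Indeed, a counterexample to openness
   that passes the tests indexed by [test] below yields an infinite sequence
   b_0, b_1, ... in some principal ideal such that no b_k is above the infimum
   of the others, and the infima of its subsequences are uncountably many
   elements of P.
   Countably many tests can be met one at a time, so a relation W on P with
   Scott open sections contains an open box around each of its points.  For a
   closed set A, the strong d-space property makes the relation "x and y have
   no common upper bound in A" such a W; hence an irreducible A is directed,
   and it is the principal ideal of its supremum. *)

Require Import Defs.
From HB Require Import structures.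
From mathcomp Require Import all_boot all_order.
From mathcomp Require Import finmap all_classical topology.

Import Order.TTheory.

Local Open Scope order_scope.
Local Open Scope classical_set_scope.

(** * The Scott and Lawson topologies; conditions (2), (3) and (4) each reduced to (1) *)

Section ScottSpace.
Context {d : Order.disp_t} {P : porderType d}.

Lemma scott_closureP (A : set P) (x : P) :
  closure (A : set (scott P)) x <->
  forall U : set P, scott_open U -> U x -> A `&` U !=set0.
Proof.
split=> [clx U oU Ux|meetA B [U [oU Ux UB]]].
  by apply: clx; exists U; split.
by have [y [Ay Uy]] := meetA U oU Ux; exists y; split=> //; exact: UB.
Qed.

Lemma scott_open_nbelow (z : P) : scott_open (~` below z).
Proof.
split=> [x y nxz xy yz|D s _ [_ sleast] nsz].
  by apply: nxz; exact: le_trans yz.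
apply: contrapT => D0; apply: nsz; apply: sleast => x Dx.
by apply: contrapT => nxz; apply: D0; exists x.
Qed.

Lemma scott_spec_leE (x y : scott P) : spec_le x y = (x <= y :> P).
Proof.
apply/propext; split=> [/scott_closureP clx|xy].
  apply: contrapT => nxy.
  by have [_ [->]] := clx _ (scott_open_nbelow y) nxy; apply; exact: le_refl.
by apply/scott_closureP => U [Uup _] Ux; exists y; split=> //; exact: Uup xy.
Qed.

Lemma scott_spec_aboveE (x : scott P) : spec_above x = above (x : P).
Proof. by apply/funext => y; exact: scott_spec_leE. Qed.

Lemma directed_spec_le (D : set P) :
  directed_for (@spec_le (scott P)) D <-> directed D.
Proof.
rewrite /directed (_ : @spec_le (scott P) = fun x y : P => x <= y) //.
by apply/funext => x; apply/funext => y; exact: scott_spec_leE.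
Qed.

Lemma strong_d_spaceP :
  strong_d_space (scott P) <->
  forall (D : set P) (x : P) (U : set P), directed D -> scott_open U ->
    \bigcap_(e in D) (above e `&` above x) `<=` U ->
    exists2 e, D e & above e `&` above x `<=` U.
Proof.
rewrite /strong_d_space (_ : @spec_above (scott P) = above).
  by split=> sd D x U /directed_spec_le; exact: sd.
by apply/funext => x; exact: scott_spec_aboveE.
Qed.

Lemma property_R_strong_d_space :
  property_R (scott P) -> strong_d_space (scott P).
Proof.
move=> propR; apply/strong_d_spaceP => D x U dirD oU DU.
(* Padding the principal filters of D with that of x; note g x = x. *)
pose g e := if e \in D then e else x.
have upg e : spec_up ([set g e] : set (scott P)) = above (g e).
  by rewrite /spec_up bigcup_set1 scott_spec_aboveE.
have [e|z zg|I0 /finite_seqP[s ->] I0U] := propR _ (fun e => [set g e]) _ _ oU.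
- exact: finite_set1.
- have gz e : g e <= z by have := zg e I; rewrite upg.
  apply: DU => e De; split; first by have := gz e; rewrite /g mem_set.
  by have := gz x; rewrite /g if_same.
(* By directedness one [e] in [D] dominates the finitely many selected indices that lie in [D]; the
   other indices only ask for [x <= z]. *)
have [e De es] : exists2 e, D e &
    forall c, c \in s -> forall z, e <= z -> x <= z -> g c <= z.
  elim: s {I0U} => [|c s [e De es]]; first by have [e De] := dirD.1; exists e.
  have [h Dh [eh ch]] : exists2 h, D h & e <= h /\ (D c -> c <= h).
    have [Dc|nDc] := pselect (D c); last by exists e.
    by have [h [Dh eh ch]] := dirD.2 _ _ De Dc; exists h.
  exists h => // b; rewrite inE => /orP[/eqP ->|bs] z hz xz; last first.
    by apply: es => //; exact: le_trans hz.
  rewrite /g; case: ifPn => // /set_mem Dc.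
  exact: le_trans (ch Dc) hz.
by exists e => // z [ez xz]; apply: I0U => c cs; rewrite upg; exact: es.
Qed.

Lemma scott_above_compact (x : P) : compact (above x : set (scott P)).
Proof.
move=> F FF Fx; exists x; split; first exact: le_refl.
move=> A B FA [U [oU Ux UB]].
have [y [Ay xy]] := filter_ex (filterI FA Fx).
by exists y; split=> //; apply: UB; exact: oU.1 xy.
Qed.

Lemma scott_upper_saturated (A : set P) :
  (forall x y, A x -> x <= y -> A y) -> saturated (A : set (scott P)).
Proof.
move=> Aup; apply/seteqP; split=> [x Ax U [_]|x Ux]; first exact.
apply: contrapT => nAx.
apply: (Ux (~` below x)); last exact: le_refl.
split; first exact: scott_open_nbelow.
by move=> y Ay yx; apply: nAx; exact: Aup yx.
Qed.

(** Principal filters are compact and saturated, so coherence makes their pairwise intersections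
    compact; as [e] runs over the directed set [D], the intersections with [above x] form a filtered
    family. *)
Lemma wf_coherent_strong_d_space :
  well_filtered (scott P) -> coherent (scott P) -> strong_d_space (scott P).
Proof.
move=> wf coh; apply/strong_d_spaceP => D x U dirD oU DU.
have aboveup (z u v : P) : above z u -> u <= v -> above z v.
  by move=> zu; exact: le_trans.
have [K|||K [e De <-]] := wf [set above e `&` above x | e in D] U _ _ oU.
- move=> [e De <-]; split.
    have sat z := scott_upper_saturated (above z) (aboveup z).
    exact (coh _ _ (scott_above_compact e) (sat e) (scott_above_compact x) (sat x)).
  apply: scott_upper_saturated => u v [eu xu] uv.
  by split; exact: aboveup uv.
- split; first by have [e De] := dirD.1; exists (above e `&` above x), e.
  move=> _ _ [e De <-] [g Dg <-]; have [h [Dh eh gh]] := dirD.2 _ _ De Dg.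
  exists (above h `&` above x); split; first by exists h.
    by move=> z [hz xz]; split=> //; exact: le_trans hz.
  by move=> z [hz xz]; split=> //; exact: le_trans hz.
- by move=> z zD; apply: DU => e De; apply: zD; exists e.
- by exists e.
Qed.

Lemma lawson_subbase_open (U : set P) :
  lawson_subbase U -> open (U : set (lawson P)).
Proof.
move=> bU; exists [set U]; last by rewrite bigcup_set1.
move=> _ ->; exists [fset U]%fset; last by rewrite set_fset1 bigcap_set1.
by move=> V /fset1P ->; rewrite inE.
Qed.

Lemma lawson_closed_setC (U : set P) :
  lawson_subbase U -> closed (~` U : set (lawson P)).
Proof. by move=> bU; apply: open_closedC; exact: lawson_subbase_open. Qed.

Lemma lawson_above_closed (x : P) : closed (above x : set (lawson P)).
Proof. by rewrite -(setCK (above x)); apply: lawson_closed_setC; right; exists x. Qed.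

(** If every [e] fails, the Lawson closed sets [B e] generate a proper filter on the compact set
    [above x]. A cluster point lies in every [B e], hence both inside and outside [U]. *)
Lemma lawson_upper_semicompact_strong_d_space :
  lawson_upper_semicompact P -> strong_d_space (scott P).
Proof.
move=> lusc; apply/strong_d_spaceP => D x U dirD oU DU.
apply: contrapT => noD.
pose B (e : P) : set (lawson P) := above e `&` above x `&` ~` U.
have FF : ProperFilter (filter_from D B).
  apply: filter_from_proper.
    apply: filter_from_filter => [|e g De Dg]; first exact: dirD.1.
    have [h [Dh eh gh]] := dirD.2 _ _ De Dg; exists h => // z [[hz xz] nUz].
    by split; split=> //; split=> //; exact: le_trans hz.
  move=> e De; apply: contrapT => B0; apply: noD; exists e => // z ez.
  by apply: contrapT => nUz; apply: B0; exists z.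
have [p [xp clp]] : above x `&` cluster (filter_from D B) !=set0.
  apply: lusc; have [e De] := dirD.1; exists e => //.
  by move=> z [[]].
have Bp e : D e -> B e p.
  move=> De; have clB : closed (B e).
    apply: closedI; first by apply: closedI; exact: lawson_above_closed.
    by apply: lawson_closed_setC; left.
  by apply: clB => A pA; apply: clp => //; exists e.
have [e De] := dirD.1.
by apply: (Bp e De).2; apply: DU => g Dg; exact: (Bp g Dg).1.
Qed.

End ScottSpace.

(** * Open boxes inside relations with Scott open sections *)

Section CountableTests.
Context {d : Order.disp_t} {P : porderType d}.
Variables (I : Type) (t : I -> P) (K : I -> set P).
Hypothesis I_countable : countable [set: I].
Hypothesis tests : forall V : set P,
  (forall x y, V x -> x <= y -> V y) ->
  (forall i, closure (K i : set (scott P)) (t i) -> V (t i) -> V `&` K i !=set0) ->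
  scott_open V.

(** The two sides of the box grow together through finite lists of tagged points, [true] for the
    left side and [false] for the right, any two opposite points being related by [W]. The upper
    sets generated by all the points pass every test. *)
Lemma countable_tests_open_box (W : P -> P -> Prop) :
  (forall y, scott_open [set x | W x y]) ->
  (forall x, scott_open [set y | W x y]) ->
  forall x y, W x y -> exists U V : set P,
    [/\ scott_open U, scott_open V, U x, V y &
        forall u v, U u -> V v -> W u v].
Proof.
move=> W1 W2 x0 y0 W0.
pose R (b : bool) u v := if b then W u v else W v u.
have oR b v : scott_open [set u | R b u v] by case: b; [exact: W1|exact: W2].
pose ok (s : seq (bool * P)) := forall u v, (true, u) \in s -> (false, v) \in s -> W u v.
have okR s b u v : ok s -> (b, u) \in s -> (~~ b, v) \in s -> R b u v.
  by case: b => oks us vs; exact: oks.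
(* The points that may still join side [b]. This is a finite intersection of open sections, so it
   meets [K i] whenever it contains a point [t i] of the closure of [K i]. *)
pose compat b (s : seq (bool * P)) : set P :=
  [set u | forall v, (~~ b, v) \in s -> R b u v].
have compat_open b s : scott_open (compat b s).
  elim: s => [|[c v] s ih].
    by rewrite (_ : compat b [::] = setT); [exact: scott_openT|apply/seteqP; split].
  case: (eqVneq c (~~ b)) => [->|cb].
    rewrite (_ : compat _ _ = [set u | R b u v] `&` compat b s).
      exact: scott_openI.
    apply/seteqP; split=> u.
      move=> h; split; first by apply: h; rewrite inE eqxx.
      by move=> w ws; apply: h; rewrite inE ws orbT.
    by move=> [h1 h2] w; rewrite inE => /orP[/eqP[->]|/h2].
  rewrite (_ : compat _ _ = compat b s) //.
  apply/seteqP; split=> u h w.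
    by move=> ws; apply: h; rewrite inE ws orbT.
  by rewrite inE => /orP[/eqP[cb']|/h //]; rewrite cb' eqxx in cb.
have ok_cons s b u : ok s -> compat b s u -> ok ((b, u) :: s).
  move=> oks bu v w; rewrite !inE => /orP[/eqP[bt vu]|vs] /orP[/eqP[bf wu]|ws].
  - by rewrite -bt in bf.
  - by move: bu; rewrite -bt vu => /(_ w ws).
  - by move: bu; rewrite -bf wu => /(_ v vs).
  - exact: oks.
have /countable_injP[e0 e0_inj] := I_countable.
(* Stage n settles the test numbered n once and for all: if s_n leaves room
   for t i on side b then an element of K i is added there, and otherwise
   t i can never enter side b. *)
pose e (p : bool * I) := choice.pickle (p.1, e0 p.2).
have e_inj b i b' i' : e (b, i) = e (b', i') -> b = b' /\ i = i'.
  by move=> /(pcan_inj choice.pickleK) [-> /e0_inj ->]; rewrite ?inE.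
pose step (p q : {s | ok s} * nat) := [/\ q.2 = p.2.+1,
  {subset sval p.1 <= sval q.1} &
  forall b i, e (b, i) = p.2 -> closure (K i : set (scott P)) (t i) ->
    compat b (sval p.1) (t i) -> exists2 u, K i u & (b, u) \in sval q.1].
have stepP p : {q | step p q}.
  apply: cid; case: p => -[s oks] n.
  have [[b [i [ein cli ci]]]|no] := pselect (exists b i,
      [/\ e (b, i) = n, closure (K i : set (scott P)) (t i) & compat b s (t i)]).
    have [u [Kiu cu]] := (scott_closureP _ _).1 cli _ (compat_open b s) ci.
    exists (exist _ _ (ok_cons _ _ _ oks cu), n.+1); split=> //=.
      by move=> z zs; rewrite inE zs orbT.
    move=> b' i' /= ein' _ _.
    have [-> ->] := e_inj _ _ _ _ (etrans ein' (esym ein)).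
    by exists u => //; rewrite inE eqxx.
  exists (exist _ _ oks, n.+1); split=> //= b i ein cli ci.
  by exfalso; apply: no; exists b, i.
have ok0 : ok [:: (true, x0); (false, y0)].
  by move=> u v; rewrite !inE !xpair_eqE orbF => /eqP -> /eqP ->.
have [f [f0 fS]] := dependent_choice stepP (exist _ _ ok0, 0%N).
pose s n := sval (f n).1.
have oks n : ok (s n) by exact: svalP (f n).1.
have f2 n : (f n).2 = n.
  by elim: n => [|n ih]; [rewrite f0|have [-> _ _] := fS n; rewrite ih].
have s_mono m n : (m <= n)%N -> {subset s m <= s n}.
  move=> /subnK <-; elim: (n - m)%N => // k ih z /ih; rewrite addSn.
  by have [_ + _] := fS (k + m)%N; apply.
pose V b : set P := [set z | exists n u, (b, u) \in s n /\ u <= z].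
have V_R b z w : V b z -> V (~~ b) w -> R b z w.
  move=> [m [u [us uz]]] [n [v [vs vw]]].
  have Ruv : R b u v.
    apply: (okR (s (maxn m n))) => //.
      by apply: s_mono us; exact: leq_maxl.
    by apply: s_mono vs; exact: leq_maxr.
  have Rzv := (oR b v).1 _ _ Ruv uz.
  by case: (b) Rzv => Rzv; [exact: (W2 z).1 vw|exact: (W1 z).1 vw].
(* A point [t i] of side [b] is related to everything ever put on the other side, so it was
   compatible at stage [e (b, i)], and the next list contains an element of [K i]. *)
have V_open b : scott_open (V b).
  apply: tests => [x y [n [u [us ux]]] xy|i cli [n [u [us ui]]]].
    by exists n, u; split=> //; exact: le_trans xy.
  have [_ _ /(_ b i)] := fS (e (b, i)); rewrite f2.
  case=> // [v vs|w Kiw ws].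
    apply: V_R; first by exists n, u.
    by exists (e (b, i)), v.
  by exists w; split=> //; exists (e (b, i)).+1, w.
exists (V true), (V false); split=> // [||u v]; last exact: V_R.
  by exists 0%N, x0; rewrite /s f0 /= !inE eqxx.
by exists 0%N, y0; rewrite /s f0 /= !inE eqxx orbT.
Qed.

End CountableTests.

(** * Countably many tests for Scott openness, and sobriety *)

Section CountableMeetContinuous.
Context {d : Order.disp_t} {P : porderType d}.
Hypothesis P_countable : countable [set: P].
Hypothesis P_sups : nonempty_sups_below P.

(** The infimum of the [b j] with [j] in [S] is obtained as the supremum of their lower bounds in
    the ideal of [r], a set which [z] makes nonempty. The [w k] recover [S] from it, so [P] would
    have as many elements as there are sets of naturals. *)
Lemma no_independent_sequence (r z : P) (b w : nat -> P) :
  (forall n, b n <= r) -> (forall n, z <= b n) ->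
  (forall j k, j <> k -> w k <= b j) -> ~ forall k, ~ (w k <= b k).
Proof.
move=> br zb wb nwb.
have glbP (S : set nat) : {g | forall k, w k <= g <-> ~ S k}.
  pose L : set P := [set c | c <= r /\ forall j, S j -> c <= b j].
  have [||g [gr gub gleast]] := cid (P_sups r L _ _).
  - by exists z; split=> [|j _]; [exact: le_trans (zb 0%N) (br 0%N)|exact: zb].
  - by move=> c [].
  have gb j : S j -> g <= b j.
    by move=> Sj; apply: gleast => [|c [_]]; [exact: br|exact].
  exists g => k; split=> [wg Sk|nSk].
    by apply: (nwb k); exact: le_trans wg (gb k Sk).
  apply: gub; split=> [|j Sj].
    by apply: le_trans (br k.+1); apply: wb; exact/nesym/n_Sn.
  by apply: wb => jk; apply: nSk; rewrite -jk.
have /countable_injP[e e_inj] := P_countable.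
pose g S := sval (glbP S).
(* Cantor's diagonal set, evaluated at its own code [e (g T)]. *)
pose T : set nat := [set n | exists S, e (g S) = n /\ ~ S n].
have nT : ~ T (e (g T)).
  move=> TT; have [S [eS nS]] := TT.
  have gST : g S = g T by apply: e_inj; rewrite ?inE.
  have := (svalP (glbP S) _).2 nS; rewrite -/(g S) gST.
  by move/(svalP (glbP T) _).1; exact.
by apply: (nT); exists T.
Qed.

(* In a lattice: the c <= t.2 whose join with t.1.2, taken in the principal
   ideal of t.1.1, is not above t.2. *)
Definition test (t : P * P * P) : set P :=
  [set c | c <= t.2 /\
    exists b, [/\ b <= t.1.1, c <= b, t.1.2 <= b & ~ (t.2 <= b)]].

Hypothesis P_mc : meet_continuous P.

Lemma meet_continuous_not_below (x b s : P) (D : set P) :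
  directed D -> isLub D s -> x <= s -> ~ (x <= b) ->
  exists w a, [/\ D a, w <= x, w <= a & ~ (w <= b)].
Proof.
move=> dirD Ds xs nxb.
have [w [[wx [a [Da wa]]] nwb]] :=
  (scott_closureP _ _).1 (P_mc _ _ _ dirD Ds xs) _ (scott_open_nbelow b) nxb.
by exists w, a.
Qed.

(** If [D] misses [V], the tests yield a descending sequence [x n] in [V] and an ascending one [a n]
    in [D]. Some [b n] is above [x n.+1] and [a n] but not above [x n], and meet-continuity gives
    [w n] below [x n] and [a n.+1] but not below [b n]. These sequences are independent in the sense
    just excluded. *)
Lemma scott_open_of_tests (V : set P) :
  (forall x y, V x -> x <= y -> V y) ->
  (forall t, closure (test t : set (scott P)) t.2 -> V t.2 ->
    V `&` test t !=set0) ->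
  scott_open V.
Proof.
move=> Vup Vtest; split=> // D r dirD Dr Vr; apply: contrapT => DV.
(* Meet-continuity puts [x] in the closure of the elements below both [x] and some [g] in [D]. A
   bound [h] in [D] of [g] and [a] is the witness for the test: [x <= h] would put [h] in [V]. *)
have test_cl a x : D a -> V x -> x <= r ->
    closure (test (r, a, x) : set (scott P)) x.
  move=> Da Vx xr; apply: closureS (P_mc _ _ _ dirD Dr xr) => c [cx [g [Dg cg]]].
  split=> //=; have [h [Dh gh ah]] := dirD.2 _ _ Dg Da.
  exists h; split=> //; [exact: Dr.1|exact: le_trans gh|move=> xh].
  by apply: DV; exists h; split=> //; exact: Vup xh.
pose X := {p : P * P | [/\ V p.1, p.1 <= r & D p.2]}.
pose step (p q : X) := [/\ (sval q).1 <= (sval p).1, (sval p).2 <= (sval q).2 &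
  exists bw : P * P,
    [/\ bw.1 <= r, (sval p).2 <= bw.1 & (sval q).1 <= bw.1] /\
    [/\ bw.2 <= (sval p).1, bw.2 <= (sval q).2 & ~ (bw.2 <= bw.1)]].
have stepP p : {q | step p q}.
  apply: cid; case: p => -[x a] /= [Vx xr Da].
  have [c [Vc [/= cx [b [/= br cb ab nxb]]]]] := Vtest _ (test_cl _ _ Da Vx xr) Vx.
  have [w [a1 [Da1 wx wa1 nwb]]] := meet_continuous_not_below _ _ _ _ dirD Dr xr nxb.
  have [a2 [Da2 aa2 a12]] := dirD.2 _ _ Da Da1.
  have q2 : [/\ V (c, a2).1, (c, a2).1 <= r & D (c, a2).2].
    by split=> //; exact: le_trans xr.
  exists (exist _ (c, a2) q2); split=> //=; exists (b, w); do 2!split=> //=.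
  exact: le_trans a12.
have [a0 Da0] := dirD.1.
have p0 : [/\ V (r, a0).1, (r, a0).1 <= r & D (r, a0).2] by [].
have [f [_ fS]] := dependent_choice stepP (exist _ (r, a0) p0).
have [bw bwP] := choice (fun n => let: And3 _ _ h := fS n in h).
pose x n := (sval (f n)).1; pose a n := (sval (f n)).2.
have x_mono m n : (m <= n)%N -> x n <= x m.
  move=> /subnK <-; elim: (n - m)%N => // k ih; rewrite addSn.
  by apply: le_trans ih; have [] := fS (k + m)%N.
have a_mono m n : (m <= n)%N -> a m <= a n.
  move=> /subnK <-; elim: (n - m)%N => // k ih; rewrite addSn.
  by apply: (le_trans ih); have [] := fS (k + m)%N.
apply: (no_independent_sequence r (a 0%N) (fun n => (bw n).1) (fun n => (bw n).2)).
- by move=> n; have [[]] := bwP n.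
- by move=> n; have [[_ ab _] _] := bwP n; exact: le_trans (a_mono _ _ (leq0n n)) ab.
- move=> j k; have [[_ ab xb] _] := bwP j; have [_ [wx wa _]] := bwP k.
  case: (ltngtP j k) => // [jk|kj] _.
    by apply: le_trans wx _; apply: le_trans xb; exact: (x_mono j.+1 k).
  by apply: le_trans wa _; apply: le_trans ab; exact: (a_mono k.+1 j).
- by move=> k; have [_ []] := bwP k.
Qed.

Lemma strong_d_space_common_upper_bound (A : set P) (x y : P) :
  strong_d_space (scott P) -> irreducible_closed (A : set (scott P)) ->
  A x -> A y -> exists z, [/\ A z, x <= z & y <= z].
Proof.
move=> /strong_d_spaceP sd [clA _ irrA] Ax Ay; apply: contrapT => noz.
have oA : scott_open (~` A) by exact: closed_openC clA.
pose W u v := above u `&` above v `<=` ~` A.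
have W1 v : scott_open [set u | W u v].
  split=> [u u' Wuv uu' z [u'z vz]|D s dirD Ds Wsv].
    by apply: Wuv; split=> //; exact: le_trans u'z.
  (* The points above all of [D] are those above its supremum [s], so [Wsv] is the inclusion that
     the strong d-space property requires. *)
  have [z zD|e De We] := sd D v _ dirD oA; last by exists e.
  have [e De] := dirD.1.
  by apply: Wsv; split; [apply: Ds.2 => g Dg; exact: (zD g Dg).1|exact: (zD e De).2].
have W2 u : scott_open [set v | W u v].
  by rewrite /W; under eq_fun do rewrite setIC; exact: W1.
have PPP : countable [set: P * P * P] by rewrite -!setXTT; do 2?apply: countableX.
have [z [xz yz] Az|U [V [oU oV Ux Vy UVW]]] :=
  countable_tests_open_box _ (fun t => t.2) test PPP scott_open_of_tests W W1 W2 x y.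
  by apply: noz; exists z.
(* Irreducibility puts a diagonal pair [(z, z)] with [z] in [A] into the box, although [z] is its
   own common upper bound in [A]. *)
have [z [Az [Uz Vz]]] : A `&` (U `&` V) !=set0.
  by apply: irrA => //; [exists x|exists y].
by apply: (UVW z z Uz Vz z) => //; split; exact: le_refl.
Qed.

Lemma strong_d_space_sober :
  is_dcpo P -> strong_d_space (scott P) -> scott_sober P.
Proof.
move=> dcpo sd A irrA; have [clA A0 _] := irrA.
have dirA : directed A.
  by split=> // x y; exact: strong_d_space_common_upper_bound.
have [a Aa] := dcpo _ dirA.
have AaA : A a.
  apply: contrapT => nAa.
  by have [x []] := (closed_openC clA : scott_open (~` A)).2 _ _ dirA Aa nAa.
have AE : A = below a.
  apply/seteqP; split=> [x Ax|x xa]; first exact: Aa.1.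
  apply: contrapT => nAx.
  by exact: (closed_openC clA : scott_open (~` A)).1 nAx xa AaA.
exists a; split=> // b Ab; apply/le_anti/andP; split.
  by have : below b a by rewrite -Ab.
by have : below a b by rewrite -AE Ab /below /=; exact: le_refl.
Qed.

End CountableMeetContinuous.

Theorem corollary5p5 (d : Order.disp_t) (P : porderType d)
    (P_nonempty : [set: P] !=set0)
    (P_countable : countable [set: P])
    (P_dcpo : is_dcpo P)
    (P_meet_continuous : meet_continuous P) :
  (nonempty_sups_below P ->
   [\/ strong_d_space (scott P),
       property_R (scott P),
       well_filtered (scott P) /\ coherent (scott P)
     | lawson_upper_semicompact P] ->
   scott_sober P) /\
  (is_L_dcpo P -> nonempty_sups_below P).
Proof.
split=> [sups cases|[_ Ldcpo] r A _ Ar]; last exact: (Ldcpo r A Ar).1.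
apply: strong_d_space_sober => //; case: cases => //.
- exact: property_R_strong_d_space.
- by case; exact: wf_coherent_strong_d_space.
- exact: lawson_upper_semicompact_strong_d_space.
Qed.
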